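(* Consider the three continuous time Markov chains below (described precisely in the context), each with its induced graph distance $d$ on the finite state space $\Omega$, and the $\infty$-coarse Ricci curvature $\mathrm{Ric}_{cc,\infty}$. (1) (Glauber dynamics) If for all $\eta\in\Omega$ and $\sigma,\gamma\in G$ one has $\sigma\gamma\eta=\gamma\sigma\eta$, $\sigma\sigma\eta=\eta$ and $\kappa(\eta,\sigma)\ge0$, then $\mathrm{Ric}_{cc,\infty}\ge\kappa_*$, where $\kappa_*=\inf_{\eta\in\Omega,\sigma\in G}(\kappa(\eta,\sigma)+\kappa(\sigma\eta,\sigma))$. (2) (Bernoulli--Laplace model with $L$ sites and $N<L$ particles) $\mathrm{Ric}_{cc,\infty}\ge L$. (3) (Hardcore model with parameter $\beta\in(0,1)$ on a simple finite connected graph of maximum degree $\Delta$) If $\beta\Delta\le1$, then $\mathrm{Ric}_{cc,\infty}\ge\kappa_*$, where $\kappa_*=1-\beta(\Delta-1)$. In particular, under the respective assumptions, for all probability measures $\mu,\nu$ on $\Omega$, all $p\in[1,\infty)$ and all $t\ge0$, $$W_p(\mu P_t,\nu P_t)\le e^{-\frac{K}{p}t}\,W_p(\mu,\nu),$$ with $K=\kappa_*$ for Glauber dynamics, $K=L$ for the Bernoulli--Laplace model, and $K=\kappa_*$ for the hardcore model.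
   Context: **Models.** Each chain is given by a finite state space $\Omega$, a finite set $G$ of moves (maps $\Omega\to\Omega$) and rates $c(\eta,\sigma)\ge0$; the generator is $\psi\mapsto\sum_{\sigma\in G}c(\eta,\sigma)(\psi(\sigma\eta)-\psi(\eta))$. Chains are assumed irreducible and reversible. - *Glauber dynamics*: $H:\Omega\to\mathbb{R}$, $\beta>0$, $c(\eta,\sigma)=\exp(-\frac\beta2(H(\sigma\eta)-H(\eta)))$, and $\kappa(\eta,\sigma)=c(\sigma\eta,\sigma)-\sum_{\gamma\in G,\gamma\ne\sigma}\max\{-(c(\sigma\eta,\gamma)-c(\eta,\gamma)),0\}$; $G$ does not contain the identity. - *Bernoulli--Laplace model*: $\Omega=\{\eta\in\{0,1\}^{L}:\sum_i\eta_i=N\}$, moves $\sigma_{ij}$ ($1\le i,j\le L$) with $\sigma_{ij}\eta=\eta-\delta_i+\delta_j$ if $\eta_i(1-\eta_j)>0$ and $\sigma_{ij}\eta=\eta$ otherwise, rates $c(\eta,\sigma_{ij})=\eta_i(1-\eta_j)$. - *Hardcore model*: for a graph $(V,E)$, $\Omega=\{\eta\in\{0,1\}^V:\eta_x\eta_y=0\text{ if }x\sim y\}$, moves $\gamma_x^\pm$ with $\gamma_x^\pm\eta=\eta\pm\delta_x$ if this is in $\Omega$ and $\eta$ otherwise, rates $c(\eta,\gamma_x^+)=\beta\prod_{y\in\bar N_x}(1-\eta_y)$ with $\bar N_x=\{x\}\cup\{y:y\sim x\}$, and $c(\eta,\gamma_x^-)=\eta_x$. **Curvature.** For $x\ne y\in\Omega$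 let $Q(x,y)=\sum_{\sigma\in G:\sigma x=y}c(x,\sigma)$ be the total jump rate from $x$ to $y$. Write $x\sim y$ if $x\ne y$ and $Q(x,y)>0$, and let $d$ be the associated unweighted graph distance. For $x\neq y$, coupling rates from $(x,y)$ are functions $C(x,y,\cdot,\cdot):\Omega\times\Omega\to[0,\infty)$ with $\sum_{w}C(x,y,w,z)=Q(y,z)$ for all $z$ and $\sum_zC(x,y,w,z)=Q(x,w)$ for all $w$; here the diagonal values $Q(x,x),Q(y,y)\ge0$ are irrelevant for the generator and may be chosen freely (depending on the pair). $K_{cc,\infty}(x,y)$ is the supremum (with $\sup\emptyset=-\infty$) of all $K\in\mathbb{R}$ for which there exist coupling rates with $$\sum_{v,z}C(x,y,v,z)\mathbf 1_{d(v,z)>d(x,y)}=0,\qquad \sum_{v,z}C(x,y,v,z)d(v,z)\le\Big(\sum_{v,z}C(x,y,v,z)-K\Big)d(x,y).$$ $\mathrm{Ric}_{cc,\infty}\ge K$ means $K_{cc,\infty}(x,y)\ge K$ for all $x\neq y$. $P_t$ is the Markov semigroup (matrix exponential of $t$ times the generator), acting on measures (row vectors) from the right, and $W_p(\mu,\nu)=\big(\inf_{\gamma}\sum_{x,y}d(x,y)^p\gamma(x,y)\big)^{1/p}$ over couplings $\gamma$ of $\mu,\nu$. *)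

(* Defs.v *)
From HB Require Import structures.
From mathcomp Require Import all_boot all_order all_algebra.
From mathcomp Require Import all_classical all_reals all_analysis.
Set Implicit Arguments.
Unset Strict Implicit.
Unset Printing Implicit Defensive.
Import Order.TTheory GRing.Theory Num.Theory.
Import numFieldNormedType.Exports.
Local Open Scope classical_set_scope.
Local Open Scope ring_scope.

(* Moves are an indexed family of maps, so that a rate may depend on the index
   (as in the Bernoulli--Laplace model, where every sigma_ii is the identity). *)
Record chain (R : realType) (T : finType) := Chain {
  moves : finType;
  act : moves -> T -> T;
  rate : T -> moves -> R;
  rate_ge0 : forall x s, 0 <= rate x s }.

Section Curvature.
Variables (R : realType) (T : finType) (X : chain R T).

Definition generator (psi : T -> R) (x : T) : R :=
  \sum_(s : moves X) rate x s * (psi (act s x) - psi x).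

(* Only the values at x != y are meaningful. *)
Definition jump_rate (x y : T) : R :=
  \sum_(s : moves X | act s x == y) rate x s.

Definition adj : rel T := [rel x y | (x != y) && (0 < jump_rate x y)].

Definition irreducible_chain : Prop := forall x y, connect adj x y.

Definition reversible_chain : Prop :=
  exists pi : T -> R, [/\ forall x, 0 < pi x, \sum_x pi x = 1 &
    forall x y, pi x * jump_rate x y = pi y * jump_rate y x].

(* Length of a shortest adj-path. A shortest path has length < #|T|; the value
   is #|T| when there is no path, which cannot happen for irreducible chains. *)
Definition gdist (x y : T) : nat :=
  find (fun n => [exists p : n.-tuple T, path adj x p && (last x p == y)])
       (iota 0 #|T|).

(* qx and qy are the free diagonal values Q(x,x) and Q(y,y). *)
Definition coupling_rates (x y : T) (C : T -> T -> R) : Prop :=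
  exists qx qy : R,
    [/\ 0 <= qx, 0 <= qy,
        forall v z, 0 <= C v z,
        forall z, \sum_v C v z = (if z == y then qy else jump_rate y z) &
        forall v, \sum_z C v z = (if v == x then qx else jump_rate x v)].

Definition Kcc_inf (x y : T) : \bar R :=
  ereal_sup [set K%:E | K in [set K : R | exists C : T -> T -> R,
    [/\ coupling_rates x y C,
        \sum_v \sum_z C v z * (gdist x y < gdist v z)%N%:R = 0 &
        \sum_v \sum_z C v z * (gdist v z)%:R
          <= (\sum_v \sum_z C v z - K) * (gdist x y)%:R]]].

Definition Ric_cc_inf_ge (K : R) : Prop :=
  forall x y, x != y -> (K%:E <= Kcc_inf x y)%E.

Definition is_prob (mu : T -> R) : Prop :=
  (forall x, 0 <= mu x) /\ \sum_x mu x = 1.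

Definition is_coupling (mu nu : T -> R) (g : T -> T -> R) : Prop :=
  [/\ forall x y, 0 <= g x y, forall x, \sum_y g x y = mu x &
      forall y, \sum_x g x y = nu y].

Definition Wp (p : R) (mu nu : T -> R) : R :=
  (inf [set r : R | exists2 g, is_coupling mu nu g &
     r = \sum_x \sum_y ((gdist x y)%:R `^ p) * g x y]) `^ p^-1.

Definition generator_mx : 'M[R]_#|T| :=
  \matrix_(i, j) generator (fun z => (z == enum_val j)%:R) (enum_val i).

Definition expmx n (A : 'M[R]_n) : 'M[R]_n :=
  \matrix_(i, j) limn (series (fun k : nat => (A ^+ k) i j / k`!%:R)).

Definition semigroup (t : R) (x y : T) : R :=
  expmx (t *: generator_mx) (enum_rank x) (enum_rank y).

Definition evolve (mu : T -> R) (t : R) (y : T) : R :=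
  \sum_x mu x * semigroup t x y.

Definition Wp_contraction (K : R) : Prop :=
  forall (mu nu : T -> R) (p t : R), is_prob mu -> is_prob nu ->
    1 <= p -> 0 <= t ->
    Wp p (evolve mu t) (evolve nu t) <= expR (- (K / p) * t) * Wp p mu nu.

End Curvature.

Section Glauber.
Variables (R : realType) (T : finType) (G : {set {ffun T -> T}}).
Variables (H : T -> R) (beta : R).

Definition glauber_rate (x : T) (s : {ffun T -> T}) : R :=
  expR (- (beta / 2) * (H (s x) - H x)).

Lemma glauber_rate_ge0 (x : T) (s : {s : {ffun T -> T} | s \in G}) :
  0 <= glauber_rate x (val s).
Proof. exact: expR_ge0. Qed.

Definition glauber : chain R T :=
  @Chain R T {s : {ffun T -> T} | s \in G} (fun s => val s)
    (fun x s => glauber_rate x (val s)) glauber_rate_ge0.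

Definition glauber_kappa (x : T) (s : {ffun T -> T}) : R :=
  glauber_rate (s x) s -
  \sum_(g in G | g != s)
    Num.max (- (glauber_rate (s x) g - glauber_rate x g)) 0.

(* inf of the empty set is 0 here; if G is empty, an irreducible chain has at
   most one state and every claim about it is vacuous or 0 <= 0. *)
Definition glauber_kappa_star : R :=
  inf [set r : R | exists x s, s \in G /\
         r = glauber_kappa x s + glauber_kappa (s x) s].

End Glauber.

Section BernoulliLaplace.
Variables (R : realType) (L N : nat).

Definition bl_state := {eta : {ffun 'I_L -> bool} | (\sum_i eta i)%N == N}.

(* The default eta of insubd is never used: the guard makes the candidate
   configuration have N particles again (bl_moveE). *)
Definition bl_move (ij : 'I_L * 'I_L) (eta : bl_state) : bl_state :=
  if val eta ij.1 && ~~ val eta ij.2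
  then insubd eta [ffun k => (k == ij.2) || (k != ij.1) && val eta k]
  else eta.

Lemma bl_moveE ij (eta : bl_state) : val eta ij.1 -> ~~ val eta ij.2 ->
  forall k, (val (bl_move ij eta) k + (k == ij.1) = val eta k + (k == ij.2))%N.
Proof.
case: ij => i j /= hi hj.
set f := [ffun k => (k == j) || (k != i) && val eta k].
have fE k : (f k + (k == i) = val eta k + (k == j))%N.
  rewrite ffunE; have [->|kj] := eqVneq k j.
    by have [ji|] := eqVneq j i; [move: hj; rewrite ji hi | rewrite (negbTE hj)].
  by have [->|] := eqVneq k i; rewrite /= ?hi //.
have f_N : (\sum_k f k)%N == N.
  rewrite -(eqn_add2r (\sum_k (k == i : nat))) -big_split /=.
  rewrite (eq_bigr _ (fun k _ => fE k)) big_split /= (eqP (valP eta)).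
  have s1 (l : 'I_L) : (\sum_(k < L) (k == l : nat) = 1)%N.
    by rewrite (bigD1 l) //= eqxx big1 // => k /negbTE ->.
  by rewrite !s1.
by move=> k; rewrite /bl_move /= hi hj /= val_insubd f_N.
Qed.

Definition bl_rate (eta : bl_state) (ij : 'I_L * 'I_L) : R :=
  (val eta ij.1)%:R * (1 - (val eta ij.2)%:R).

Lemma bl_rate_ge0 eta ij : 0 <= bl_rate eta ij.
Proof. by rewrite /bl_rate mulr_ge0 // subr_ge0 lern1 leq_b1. Qed.

Definition bernoulli_laplace : chain R bl_state :=
  @Chain R bl_state ('I_L * 'I_L)%type bl_move bl_rate bl_rate_ge0.

End BernoulliLaplace.

Section Hardcore.
Variables (R : realType) (V : finType) (e : rel V) (beta : R).

Definition max_degree : nat := \max_(x : V) #|[set y | e x y]|.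

Definition hc_state := {eta : {ffun V -> bool} |
  [forall x, forall y, e x y ==> ~~ (eta x && eta y)]}.

(* (x, true) is gamma_x^+ and (x, false) is gamma_x^-. If eta + delta_x or
   eta - delta_x leaves {0,1}^V, the configuration below is eta itself; if the
   exclusion rule is violated, insubd returns eta. *)
Definition hc_move (m : V * bool) (eta : hc_state) : hc_state :=
  insubd eta (if m.2 then [ffun k => (k == m.1) || val eta k]
              else [ffun k => (k != m.1) && val eta k]).

Definition hc_rate (eta : hc_state) (m : V * bool) : R :=
  if m.2 then beta * \prod_(y | (y == m.1) || e m.1 y) (1 - (val eta y)%:R)
  else (val eta m.1)%:R.

Lemma hc_rate_ge0 (beta_gt0 : 0 < beta) eta m : 0 <= hc_rate eta m.
Proof.
rewrite /hc_rate; case: m.2 => //.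
apply: mulr_ge0; first exact: ltW.
by apply: prodr_ge0 => y _; rewrite subr_ge0 lern1 leq_b1.
Qed.

Definition hardcore (beta_gt0 : 0 < beta) : chain R hc_state :=
  @Chain R hc_state (V * bool)%type hc_move hc_rate (hc_rate_ge0 beta_gt0).

End Hardcore.

(* Main.v *)
Require Import Defs.
From mathcomp Require Import all_boot all_order all_algebra.
From mathcomp Require Import all_classical all_reals all_analysis.
From mathcomp Require Import perm ring lra.
Import Order.TTheory GRing.Theory Num.Theory.
Import numFieldNormedType.Exports.
Local Open Scope ring_scope.

Set Implicit Arguments.
Unset Strict Implicit.
Unset Printing Implicit Defensive.

(** It is enough to couple the jumps from adjacent states so that the copies
    stay equal or adjacent and merge at total rate at least [K]. For large [M]
    these become couplings of the rows of the stochastic matrix [1 + L/M], with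
    [L] the generator; gluing them along a geodesic from [x] to [y] gives a
    coupling supported on distances at most [d(x, y)], with mean distance at
    most [(1 - K/M) d(x, y)]. Rescaled by [M] it witnesses [K_cc,oo(x, y) >= K].
    As the distance does not increase, the mean of its [p]-th power also
    contracts by [1 - K/M]. Since [P_t] is the mixture of the powers
    [(1 + L/M)^m] with Poisson weights of parameter [tM], the mixed couplings
    contract by [e^(-tM) e^(tM(1 - K/M)) = e^(-Kt)]. *)

(** * Graph distance and gluing of couplings *)

Section GraphDistance.
Variables (R : realType) (T : finType) (X : chain R T).

(** The search in [gdist] never returns more than [#|T|], so long paths satisfy the bound trivially,
    and a path shorter than the returned value would have stopped the search earlier. *)
Lemma gdist_path_le x p : path (adj X) x p ->
  (gdist X x (last x p) <= size p)%N.
Proof.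
move=> xp; rewrite leqNgt; apply/negP => lt_p.
have lt_T : (size p < #|T|)%N.
  by apply: leq_trans lt_p _; rewrite -[leqRHS](size_iota 0) find_size.
have := before_find 0%N lt_p; rewrite nth_iota // add0n.
by move/negbT/existsP; apply; exists (in_tuple p); rewrite /= xp eqxx.
Qed.

(** Removing loops from a path leaves distinct vertices, so its length is below [#|T|] and the
    bounded search in [gdist] succeeds. *)
Lemma gdist_geodesic x y : connect (adj X) x y ->
  exists p, [/\ path (adj X) x p, last x p = y & size p = gdist X x y].
Proof.
move=> /connectP[p0 xp0 ->]; case: (shortenP xp0) => p xp up _.
have lt_p : (size p < #|T|)%N by have := card_uniqP up; rewrite /= => <-;
  exact: max_card.
have hp : has (fun n => [exists q : n.-tuple T,
    path (adj X) x q && (last x q == last x p)]) (iota 0 #|T|).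
  apply/hasP; exists (size p); first by rewrite mem_iota.
  by apply/existsP; exists (in_tuple p); rewrite /= xp eqxx.
have := nth_find 0%N hp; rewrite -/(gdist X x (last x p)) nth_iota; last first.
  by rewrite has_find size_iota in hp.
by case/existsP=> q /andP[xq /eqP lq]; exists q; rewrite size_tuple.
Qed.

Lemma gdist_refl x : gdist X x x = 0%N.
Proof. by apply/eqP; rewrite -leqn0; exact: (@gdist_path_le x [::]). Qed.

Lemma gdist_adj_le x y : adj X x y -> (gdist X x y <= 1)%N.
Proof. by move=> xy; apply: (@gdist_path_le x [:: y]); rewrite /= xy. Qed.

Lemma gdist_triangle x y z : irreducible_chain X ->
  (gdist X x z <= gdist X x y + gdist X y z)%N.
Proof.
move=> irr; have [p [xp py <-]] := gdist_geodesic (irr x y).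
have [q [yq qz <-]] := gdist_geodesic (irr y z).
rewrite -size_cat -qz -py -last_cat; apply: gdist_path_le.
by rewrite cat_path xp py.
Qed.

End GraphDistance.

Section Couplings.
Variables (R : realType) (T : finType).
Implicit Types (mu nu rho : T -> R) (g : T -> T -> R).

Lemma coupling_le mu nu g x y : is_coupling mu nu g -> g x y <= nu y.
Proof.
case=> g0 _ <-; rewrite (bigD1 x) //= lerDl.
by apply: sumr_ge0.
Qed.

Lemma coupling_marginal_ge0 mu nu g y : is_coupling mu nu g -> 0 <= nu y.
Proof. by case=> g0 _ <-; exact: sumr_ge0. Qed.

Lemma coupling_transpose mu nu g :
  is_coupling mu nu g -> is_coupling nu mu (fun x y => g y x).
Proof. by case. Qed.

(* The joint law is the Markov composition [g x y * h y z / nu y]; where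
   [nu y = 0] both [g _ y] and [h y _] vanish. *)
Lemma coupling_glue mu nu rho g h : is_coupling mu nu g -> is_coupling nu rho h ->
  exists k : T -> T -> T -> R,
    [/\ forall x y z, 0 <= k x y z,
        forall x y, \sum_z k x y z = g x y &
        forall y z, \sum_x k x y z = h y z].
Proof.
move=> cg ch; have nu0 y := coupling_marginal_ge0 y cg.
case: (cg) => g0 gl gr; case: (ch) => h0 hl hr.
exists (fun x y z => g x y * h y z / nu y); split=> [x y z|x y|y z].
- by rewrite divr_ge0 ?mulr_ge0.
- rewrite -mulr_suml -mulr_sumr hl.
  have [y0|y0] := eqVneq (nu y) 0; last by rewrite mulfK.
  rewrite y0 mulr0 mul0r; apply/esym/eqP; rewrite eq_le g0 -y0.
  by rewrite (coupling_le _ _ cg).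
- rewrite -mulr_suml -mulr_suml gr.
  have [y0|y0] := eqVneq (nu y) 0; last by rewrite mulrC mulKf.
  rewrite y0 !mul0r; apply/esym/eqP; rewrite eq_le h0 -y0.
  by rewrite (coupling_le _ _ (coupling_transpose ch)).
Qed.

Lemma coupling_compose mu nu rho g h k :
  is_coupling mu nu g -> is_coupling nu rho h ->
  (forall x y z, 0 <= k x y z) ->
  (forall x y, \sum_z k x y z = g x y) -> (forall y z, \sum_x k x y z = h y z) ->
  is_coupling mu rho (fun x z => \sum_y k x y z).
Proof.
move=> [g0 gl gr] [h0 hl hr] k0 kl kr; split=> [x y|x|z].
- exact: sumr_ge0.
- by rewrite exchange_big /= -gl; apply: eq_bigr => y _; rewrite kl.
- by rewrite exchange_big /= -hr; apply: eq_bigr => y _; rewrite kr.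
Qed.

End Couplings.

(** * Couplings of the lazy chain [1 + L/M] *)

Section LazyCouplings.
Variables (R : realType) (T : finType) (X : chain R T).

(** The entry at [(x, z)] of [1 + L/M]: the generator applied to the indicator of [z] yields the
    entry of [L], diagonal included. *)
Definition lazy (M : R) (x z : T) : R :=
  (z == x)%:R + generator X (fun v => (v == z)%:R) x / M.

Lemma generator_indic x z : z != x ->
  generator X (fun v => (v == z)%:R) x = jump_rate X x z.
Proof.
move=> /negbTE zx; rewrite /generator /jump_rate [RHS]big_mkcond /=.
apply: eq_bigr => s _; rewrite [x == z]eq_sym zx subr0.
by case: eqP; rewrite ?mulr1 ?mulr0.
Qed.

Lemma sum_indic (F : T -> R) x : \sum_z (z == x)%:R * F z = F x.
Proof.
by rewrite (bigD1 x) //= eqxx mul1r big1 ?addr0 // => z /negbTE ->; rewrite mul0r.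
Qed.

Lemma sum_indic1 (x : T) : \sum_z (z == x)%:R = 1 :> R.
Proof.
by rewrite -[RHS](sum_indic (fun=> 1) x); apply: eq_bigr => z _; rewrite mulr1.
Qed.

Lemma sum_generator_indic x : \sum_z generator X (fun v => (v == z)%:R) x = 0.
Proof.
rewrite /generator exchange_big big1 // => s _; rewrite -mulr_sumr sumrB.
under eq_bigr do rewrite eq_sym.
under [X in _ - X]eq_bigr do rewrite eq_sym.
by rewrite !sum_indic1 subrr mulr0.
Qed.

Lemma sum_lazy M x : \sum_z lazy M x z = 1.
Proof.
by rewrite big_split /= sum_indic1 -mulr_suml sum_generator_indic mul0r addr0.
Qed.

Lemma jump_rate_ge0 x z : 0 <= jump_rate X x z.
Proof. by apply: sumr_ge0 => s _; exact: rate_ge0. Qed.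

(** Off the diagonal the entry is a jump rate over [M]; on the diagonal the generator subtracts at
    most the total rate, which is at most [M]. *)
Lemma lazy_ge0 M x z : 0 < M -> \sum_(s : moves X) rate x s <= M ->
  0 <= lazy M x z.
Proof.
move=> M0 leM; rewrite /lazy; case: (eqVneq z x) => [->|zx]; last first.
  by rewrite add0r generator_indic // divr_ge0 ?jump_rate_ge0 // ltW.
rewrite -[X in X + _](mulfV (lt0r_neq0 M0)) -mulrDl divr_ge0 ?(ltW M0)//.
rewrite -[X in X <= _](subrr (\sum_(s : moves X) rate x s)) lerD// /generator
  -sumrN ler_sum // => s _.
by rewrite eqxx mulrBr mulr1 lerBrDl subrr mulr_ge0 ?rate_ge0.
Qed.

(* A coupling of the jumps from [x] and from [y], listed as joint jumps to
   [(a i, b i)] at rate [w i] which keep the two copies equal or adjacent and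
   merge them at total rate at least [K]. *)
Definition jump_coupling (K : R) (x y : T) : Prop :=
  exists (I : finType) (w : I -> R) (a b : I -> T),
    [/\ forall i, 0 <= w i,
        forall psi, \sum_i w i * (psi (a i) - psi x) = generator X psi x,
        forall psi, \sum_i w i * (psi (b i) - psi y) = generator X psi y,
        forall i, 0 < w i -> (a i == b i) || adj X (a i) (b i) &
        K <= \sum_i w i * (a i == b i)%:R].

(** The bound [n] is kept separate from [gdist X x y] so that gluing can add the bounds step by step
    along a path. *)
Definition contracting_coupling (K M : R) (x y : T) (n : nat)
    (g : T -> T -> R) : Prop :=
  [/\ is_coupling (lazy M x) (lazy M y) g,
      forall v z, 0 < g v z -> (gdist X v z <= n)%N &
      \sum_v \sum_z g v z * (gdist X v z)%:R <= (1 - K / M) * n%:R].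

(** Perform the joint jump [i] with probability [w i / M] and let both copies rest otherwise, which
    requires [M] to be at least the total rate [W]. The mean distance is then at most
    [(W - K) / M + (1 - W / M)]. *)
Lemma jump_coupling_contracting K x y : adj X x y -> jump_coupling K x y ->
  (\forall M \near +oo, exists g, contracting_coupling K M x y 1 g)%classic.
Proof.
move=> xy [I [w [a [b [w0 wa wb wadj wK]]]]]; pose W := \sum_i w i.
have W0 : 0 <= W by exact: sumr_ge0.
(* The generator identity, tested on the indicator of [v], identifies both marginals of the coupling
   [g] below. *)
have marg x' (c : I -> T) M v : 0 < M ->
    (forall psi, \sum_i w i * (psi (c i) - psi x') = generator X psi x') ->
    M^-1 * (\sum_i w i * (v == c i)%:R) + (1 - W / M) * (v == x')%:R =
    lazy M x' v.
  move=> M0 wc; rewrite /lazy -wc.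
  under [X in _ = _ + X / _]eq_bigr do
    rewrite mulrBr [c _ == v]eq_sym [x' == v]eq_sym.
  by rewrite sumrB -mulr_suml -/W; ring.
near=> M.
have M0 : 0 < M by near: M; exact: nbhs_pinfty_gt.
have WM : W <= M by near: M; apply: nbhs_pinfty_ge; exact: num_real.
pose g v z := M^-1 * (\sum_i w i * ((v == a i)%:R * (z == b i)%:R))
  + (1 - W / M) * ((v == x)%:R * (z == y)%:R).
have p0 : 0 <= 1 - W / M by rewrite subr_ge0 ler_pdivrMr // mul1r.
have M'0 : 0 <= M^-1 by rewrite invr_ge0 ltW.
exists g; split.
- split.
  + move=> v z; rewrite addr_ge0 // mulr_ge0 ?mulr_ge0 //.
    by apply: sumr_ge0 => i _; rewrite !mulr_ge0.
  + move=> v; rewrite big_split /= -mulr_sumr -(marg _ a) //.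
    rewrite exchange_big /= -[X in _ + X = _]mulr_sumr.
    rewrite -[X in _ + _ * X = _]mulr_sumr sum_indic1 mulr1.
    congr (_ * _ + _); apply: eq_bigr => i _.
    by rewrite -mulr_sumr -mulr_sumr sum_indic1 mulr1.
  + move=> z; rewrite big_split /= -mulr_sumr -(marg _ b) //.
    rewrite exchange_big /= -[X in _ + X = _]mulr_sumr.
    rewrite -[X in _ + _ * X = _]mulr_suml sum_indic1 mul1r.
    congr (_ * _ + _); apply: eq_bigr => i _.
    by rewrite -mulr_sumr -mulr_suml sum_indic1 mul1r.
- move=> v z g0; rewrite leqNgt; apply/negP => d1; move: g0; rewrite /g.
  rewrite big1 ?mulr0 ?add0r => [|i _]; last first.
    case: (v =P a i) => [va|]; last by rewrite mul0r mulr0.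
    case: (z =P b i) => [zb|]; last by rewrite !mulr0.
    have := w0 i; rewrite le_eqVlt => /predU1P[<-|wi]; first by rewrite mul0r.
    move: d1; rewrite va zb; case/orP: (wadj _ wi) => [/eqP ->|/gdist_adj_le].
      by rewrite gdist_refl.
    by rewrite leqNgt => /negbTE ->.
  case: (v =P x) => [vx|]; last by rewrite mul0r mulr0 ltxx.
  case: (z =P y) => [zy|]; last by rewrite !mulr0 ltxx.
  by move: d1; rewrite vx zy ltnNge gdist_adj_le.
- rewrite mulr1 /g.
  have -> : \sum_v \sum_z g v z * (gdist X v z)%:R =
    M^-1 * (\sum_i w i * (gdist X (a i) (b i))%:R)
      + (1 - W / M) * (gdist X x y)%:R.
    have E (c : R) (x' y' : T) :
        \sum_v \sum_z c * ((v == x')%:R * (z == y')%:R) * (gdist X v z)%:R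
        = c * (gdist X x' y')%:R.
      under eq_bigr do under eq_bigr do rewrite -!mulrA.
      under eq_bigr do rewrite -!mulr_sumr sum_indic.
      by rewrite -mulr_sumr sum_indic.
    rewrite -E.
    under [X in _ = _ * X + _]eq_bigr do rewrite -E.
    rewrite [X in _ = _ * X + _]exchange_big mulr_sumr -big_split /=;
      apply: eq_bigr => v _.
    rewrite [X in _ = _ * X + _]exchange_big mulr_sumr -big_split /=;
      apply: eq_bigr => z _.
    by rewrite /g mulrDl -mulrA mulr_suml.
  (* For every joint jump of positive rate, the new distance plus the merging indicator is at most
     1. *)
  have le1 : \sum_i w i * (gdist X (a i) (b i))%:R <= W - K.
    rewrite lerBrDr (le_trans (lerD (lexx _) wK)) // -big_split /= ler_sum //
      => i _.
    have := w0 i; rewrite le_eqVlt => /predU1P[<-|wi];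
      first by rewrite !mul0r addr0.
    rewrite -mulrDr -natrD ler_piMr // (_ : 1 = 1%:R) // ler_nat.
    case/orP: (wadj _ wi) => [/eqP ->|ab]; first by rewrite gdist_refl eqxx.
    have := ab; rewrite /adj /= => /andP[/negbTE -> _].
    by rewrite addn0 gdist_adj_le.
  have := ler_wpM2l M'0 le1.
  have : (1 - W / M) * (gdist X x y)%:R <= 1 - W / M.
    by rewrite ler_piMr // (_ : 1 = 1%:R) // ler_nat gdist_adj_le.
  move=> h1 h2; apply: (le_trans (lerD h2 h1)).
  by rewrite mulrBr; lra.
Unshelve. all: by end_near.
Qed.

(** Under the joint law [k] of the three copies, the triangle inequality holds pointwise; it gives
    the support bound and, after averaging, the bound on the mean. *)
Lemma contracting_coupling_glue K M x y z m n g h : irreducible_chain X ->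
  contracting_coupling K M x y m g -> contracting_coupling K M y z n h ->
  exists k, contracting_coupling K M x z (m + n) k.
Proof.
move=> irr [cg gs gd] [ch hs hd].
have [k [k0 kl kr]] := coupling_glue cg ch.
exists (fun u w => \sum_v k u v w); split.
- exact: coupling_compose cg ch k0 kl kr.
- move=> u w; rewrite lt0r psumr_neq0 // => /andP[/hasP[v _ /= kv] _].
  apply: leq_trans (gdist_triangle u v w irr) _.
  rewrite leq_add // ?gs ?hs // -?kl -?kr.
    by rewrite (bigD1 w) //= ltr_pwDl ?sumr_ge0.
  by rewrite (bigD1 u) //= ltr_pwDl ?sumr_ge0.
- rewrite natrD mulrDr; apply: le_trans (lerD gd hd).
  under [X in _ <= X + _]eq_bigr do under eq_bigr do rewrite -kl mulr_suml.
  under [X in _ <= _ + X]eq_bigr do under eq_bigr do rewrite -kr mulr_suml.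
  rewrite [X in _ <= _ + X](eq_bigr (fun v =>
    \sum_u \sum_w k u v w * (gdist X v w)%:R)); last first.
    by move=> v _; rewrite exchange_big.
  rewrite [X in _ <= _ + X]exchange_big -big_split /= ler_sum // => u _.
  rewrite -big_split /= (eq_bigr (fun w => \sum_v k u v w * (gdist X u w)%:R));
    last first.
    by move=> w _; rewrite mulr_suml.
  rewrite exchange_big ler_sum // => v _; rewrite -big_split ler_sum //= => w _.
  by rewrite -mulrDr -natrD ler_wpM2l // ler_nat gdist_triangle.
Qed.

(** Both copies make the same jump and stay together. *)
Lemma contracting_coupling_diag K M x :
  0 < M -> \sum_(s : moves X) rate x s <= M ->
  exists g, contracting_coupling K M x x 0 g.
Proof.
move=> M0 Mx; exists (fun v z => (z == v)%:R * lazy M x v); split.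
- split=> [v z|v|z].
  + by rewrite mulr_ge0 ?lazy_ge0.
  + by rewrite -mulr_suml sum_indic1 mul1r.
  + by under eq_bigr do rewrite eq_sym; rewrite sum_indic.
- by move=> v z; case: eqP => [->|]; rewrite ?mul0r ?ltxx // gdist_refl.
- rewrite mulr0 big1 // => v _; rewrite big1 // => z _.
  by case: eqP => [->|]; rewrite ?mul0r ?mulr0 // gdist_refl mulr0.
Qed.

Theorem contracting_coupling_exists K : irreducible_chain X ->
  (forall x y, adj X x y -> jump_coupling K x y) ->
  exists M, [/\ 0 < M, K <= M & forall x y, exists g,
    contracting_coupling K M x y (gdist X x y) g].
Proof.
move=> irr jc.
(* There are finitely many states and pairs, so one large [M] serves all of them. *)
have : (\forall M \near +oo, [/\ 0 < M, K <= M,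
  forall x, \sum_(s : moves X) rate x s <= M &
  forall x y, adj X x y -> exists g, contracting_coupling K M x y 1 g])%classic.
  near=> M; split; near: M.
  - exact: nbhs_pinfty_gt.
  - by apply: nbhs_pinfty_ge; exact: num_real.
  - by apply: filter_forall => x; apply: nbhs_pinfty_ge; exact: num_real.
  - apply: filter_forall => x; apply: filter_forall => y.
    case: (boolP (adj X x y)) => [xy|_]; last exact: nearW.
    by apply: filterS (jump_coupling_contracting xy (jc _ _ xy)) => M + _.
case/filter_ex => M [M0 KM exM adjM]; exists M; split=> // x y.
have [p [xp <- <-]] := gdist_geodesic (irr x y).
(* Induction along the geodesic: each edge contributes 1 to the bound, so the total is its length,
   the distance. *)
elim: p x xp => [|x' p IHp] x /=.
  by move=> _; exact: contracting_coupling_diag.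
case/andP=> /adjM[g cg] /IHp[h ch].
by have := contracting_coupling_glue irr cg ch; rewrite add1n.
Unshelve. all: by end_near.
Qed.

End LazyCouplings.

(** * Uniformization of the matrix exponential *)

Section MatrixExponential.
Variable R : realType.

(** Both sides sum [f k * g l] over the triangle [k + l < n], once by antidiagonals and once by
    columns. *)
Lemma cauchy_product_triangle (f g : nat -> R) n :
  \sum_(0 <= m < n) \sum_(0 <= k < m.+1) f k * g (m - k)%N =
  \sum_(0 <= k < n) f k * \sum_(0 <= l < n - k) g l.
Proof.
elim: n => [|n IHn]; first by rewrite !big_geq.
rewrite [LHS]big_nat_recr //= IHn [RHS]big_nat_recr //= subSnn big_nat1.
rewrite [X in _ + X = _]big_nat_recr //= subnn addrA; congr (_ + _).
rewrite -big_split /= !big_nat; apply: eq_bigr => k /andP[_ kn].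
by rewrite subSn ?(ltnW kn)// big_nat_recr //= mulrDr.
Qed.

(** Removing the triangle from the square [k, l < n] leaves the corner [k + l >= n]. In this form,
    errors of two products can be compared term by term. *)
Lemma cauchy_product_error (f g : nat -> R) n :
  (\sum_(0 <= k < n) f k) * (\sum_(0 <= l < n) g l)
    - \sum_(0 <= m < n) \sum_(0 <= k < m.+1) f k * g (m - k)%N =
  \sum_(0 <= k < n) f k * \sum_(n - k <= l < n) g l.
Proof.
rewrite cauchy_product_triangle mulr_suml -sumrB; apply: eq_bigr => k _.
rewrite -mulrBr; congr (_ * _).
rewrite [X in X - _](@big_cat_nat _ _ _ (n - k)%N) ?leq_subr //=.
by rewrite addrAC subrr add0r.
Qed.

Lemma exp_coeffD (x y : R) m :
  exp_coeff (x + y) m =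
  \sum_(0 <= k < m.+1) exp_coeff x k * exp_coeff y (m - k)%N.
Proof.
rewrite /exp_coeff /= addrC exprDn mulr_suml big_mkord; apply: eq_bigr => k _.
have km : (k <= m)%N by rewrite -ltnS.
rewrite -mulr_natl -(bin_fact km) !natrM.
have bin0 : ('C(m, k)%:R : R) != 0 by rewrite pnatr_eq0 -lt0n bin_gt0.
have f0 i : (i`!%:R : R) != 0 by rewrite pnatr_eq0 -lt0n fact_gt0.
by field; rewrite !f0.
Qed.

Variables (n : nat) (A : 'M[R]_n).

(** The entrywise l1 norm of [A]; it dominates every row sum, so its powers bound the entries of the
    powers of [A]. *)
Let c : R := \sum_i \sum_j `|A i j|.

Lemma mx_exp_entry_le k i j : `|(A ^+ k) i j| <= c ^+ k.
Proof.
elim: k i j => [|k IHk] i j.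
  by rewrite !expr0 mxE; case: eqP; rewrite ?normr1 // normr0.
rewrite exprS mxE; apply: (le_trans (ler_norm_sum _ _ _)).
rewrite exprS; apply: (@le_trans _ _ (\sum_l `|A i l| * c ^+ k)).
  by apply: ler_sum => l _; rewrite normrM ler_wpM2l.
rewrite -mulr_suml ler_wpM2r ?exprn_ge0 //.
  by rewrite sumr_ge0 // => ? _; rewrite sumr_ge0.
by rewrite /c [leRHS](bigD1 i) //= lerDl sumr_ge0 // => ? _; rewrite sumr_ge0.
Qed.

Let entry i j k := (A ^+ k) i j / k`!%:R.

Lemma entry_le i j k : `|entry i j k| <= exp_coeff c k.
Proof. by rewrite normrM normfV normr_nat ler_pM2r ?mx_exp_entry_le. Qed.

Lemma expmx_cvg i j : (series (entry i j) @ \oo --> expmx A i j)%classic.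
Proof.
rewrite mxE; apply: normed_cvg.
apply: (series_le_cvg _ _ (entry_le i j) (is_cvg_series_exp_coeff c)) => //= k.
by rewrite (le_trans _ (entry_le i j k)).
Qed.

(** The scalar matrix commutes with [A], so the binomial theorem applies. *)
Lemma mx_exp_coeffD (s : R) m i j :
  ((A + s%:M) ^+ m) i j / m`!%:R =
  \sum_(0 <= k < m.+1) entry i j k * exp_coeff s (m - k)%N.
Proof.
rewrite addrC exprDn_comm; last exact/esym/scalar_mxC.
rewrite summxE mulr_suml big_mkord; apply: eq_bigr => k _.
have km : (k <= m)%N by rewrite -ltnS.
rewrite mulmxnE -[X in X / _]mulr_natl -(bin_fact km) !natrM.
rewrite (_ : s%:M ^+ (m - k) = (s ^+ (m - k))%:M); last first.
  by rewrite rmorphXn.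
rewrite -[_ * A ^+ k]/((s ^+ (m - k))%:M *m A ^+ k) mul_scalar_mx mxE /entry
  /exp_coeff /=.
have bin0 : ('C(m, k)%:R : R) != 0 by rewrite pnatr_eq0 -lt0n bin_gt0.
have f0 l : (l`!%:R : R) != 0 by rewrite pnatr_eq0 -lt0n fact_gt0.
by field; rewrite !f0.
Qed.

(* The error of the truncated Cauchy product is dominated by that of the scalar
   product [expR c * expR s], which tends to 0 by [expRD]. *)
Lemma expmxD_scalar_cvg (s : R) i j : 0 <= s ->
  (series (fun m => ((A + s%:M) ^+ m) i j / m`!%:R) @ \oo -->
    expmx A i j * expR s)%classic.
Proof.
move=> s0.
have cvgs x : (series (exp_coeff x) @ \oo --> expR x)%classic :=
  is_cvg_series_exp_coeff x.
pose err N : R := series (exp_coeff c) N * series (exp_coeff s) N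
  - series (exp_coeff (c + s)) N.
have err0 : (err @ \oo --> (0 : R))%classic.
  rewrite -(subrr (expR (c + s))) {1}expRD; apply: cvgB; last exact: cvgs.
  by apply: cvgM; exact: cvgs.
pose dif N : R := series (entry i j) N * series (exp_coeff s) N
  - series (fun m => ((A + s%:M) ^+ m) i j / m`!%:R) N.
(* Both errors are sums over the same corner, where [entry_le] compares the terms. *)
have dif_le N : `|dif N| <= err N.
  rewrite /dif /err /series /=.
  under [X in `|_ - X|]eq_bigr do rewrite mx_exp_coeffD.
  under [X in _ <= _ - X]eq_bigr do rewrite exp_coeffD.
  rewrite !cauchy_product_error; apply: (le_trans (ler_norm_sum _ _ _)).
  apply: ler_sum => k _; rewrite normrM.
  have t0 : 0 <= \sum_(N - k <= l < N) exp_coeff s l.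
    by apply: sumr_ge0 => l _; rewrite exp_coeff_ge0.
  by rewrite (ger0_norm t0) ler_wpM2r ?entry_le.
have dif0 : (dif @ \oo --> (0 : R))%classic.
  apply: (@squeeze_cvgr _ _ _ _ (fun N => - err N) err) => //.
    by apply: nearW => N; rewrite -ler_norml dif_le.
  by rewrite -oppr0; apply: cvgN.
have -> : series (fun m => ((A + s%:M) ^+ m) i j / m`!%:R) =
    (fun N => series (entry i j) N * series (exp_coeff s) N - dif N).
  by apply/funext => N; rewrite /dif; ring.
rewrite -[X in (_ --> X)%classic]subr0; apply: cvgB => //.
by apply: cvgM; [exact: expmx_cvg | exact: cvgs].
Qed.

End MatrixExponential.

(** * Contraction along the semigroup *)

Section CouplingMixtures.
Variables (R : realType) (T : finType).
Implicit Types (mu nu : nat -> T -> R) (g : nat -> T -> T -> R).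

Lemma eq_cvgn (u v : R^nat) (l : R) : u =1 v ->
  (u @ \oo --> l)%classic -> (v @ \oo --> l)%classic.
Proof. by move=> /funext ->. Qed.

Lemma cvgn_sum (I : finType) (f : I -> R^nat) (l : I -> R) :
  (forall i, f i n @[n --> \oo] --> l i)%classic ->
  (\sum_i f i n @[n --> \oo] --> \sum_i l i)%classic.
Proof.
move=> fl; apply: cvg_big => [|i _]; last exact: fl.
by move=> x; exact: add_continuous.
Qed.

(** The partial mixtures increase and stay below the limiting second marginal, so they converge
    entrywise. Since [T] is finite, the marginals and the cost pass to the limit. *)
Lemma coupling_mixture (q : R^nat) mu nu g (r : R^nat) (D : T -> T -> R)
    (mu_oo nu_oo : T -> R) (r_oo : R) :
  (forall m, 0 <= q m) -> (forall m, is_coupling (mu m) (nu m) (g m)) ->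
  (forall m, \sum_x \sum_y D x y * g m x y <= r m) ->
  (forall x, series (fun m => q m * mu m x) @ \oo --> mu_oo x)%classic ->
  (forall x, series (fun m => q m * nu m x) @ \oo --> nu_oo x)%classic ->
  (series (fun m => q m * r m) @ \oo --> r_oo)%classic ->
  exists2 h, is_coupling mu_oo nu_oo h & \sum_x \sum_y D x y * h x y <= r_oo.
Proof.
move=> q0 cg gr mucv nucv rcv; pose S x y := series (fun m => q m * g m x y).
have g0 m x y : 0 <= g m x y by case: (cg m).
have S_nd x y : {homo S x y : n m / (n <= m)%N >-> n <= m}.
  by apply: nondecreasing_series => n _ _; rewrite mulr_ge0.
have S_cv x y : (S x y @ \oo --> limn (S x y))%classic.
  apply: nondecreasing_is_cvgn => //; exists (nu_oo y) => _ [N _ <-].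
  apply: (@le_trans _ _ (series (fun m => q m * nu m y) N)).
    by apply: ler_sum => m _; rewrite ler_wpM2l // (coupling_le _ _ (cg m)).
  rewrite -(cvg_lim _ (nucv y)) //; apply: nondecreasing_cvgn_le; last first.
    by apply/cvg_ex; exists (nu_oo y); exact: nucv.
  apply: nondecreasing_series => n _ _.
  by rewrite mulr_ge0 // (coupling_marginal_ge0 _ (cg n)).
exists (fun x y => limn (S x y)); first split.
- move=> x y; apply: (@le_trans _ _ (S x y 0%N)).
    by rewrite /S /series /= big_geq.
  apply: nondecreasing_cvgn_le; first exact: S_nd.
  by apply/cvg_ex; exists (limn (S x y)); exact: S_cv.
- move=> x; rewrite -(cvg_lim _ (mucv x)) // -(cvg_lim _ (cvgn_sum (S_cv x))) //.
  congr (limn _); apply/funext => N; rewrite /S /series /= exchange_big.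
  by apply: eq_bigr => m _; rewrite -mulr_sumr; case: (cg m) => _ ->.
- move=> y; rewrite -(cvg_lim _ (nucv y)) //.
  rewrite -(cvg_lim _ (cvgn_sum (S_cv^~ y))) //.
  congr (limn _); apply/funext => N; rewrite /S /series /= exchange_big.
  by apply: eq_bigr => m _; rewrite -mulr_sumr; case: (cg m) => _ _ ->.
- have cv : (\sum_x \sum_y D x y * S x y n @[n --> \oo] -->
      \sum_x \sum_y D x y * limn (S x y))%classic.
    by do 2 apply: cvgn_sum => ?; apply: cvgMl_tmp; exact: S_cv.
  apply: (ler_cvg_to cv rcv); apply: nearW => N.
  rewrite (_ : \sum_x _ =
      \sum_(0 <= m < N) q m * (\sum_x \sum_y D x y * g m x y)).
    by apply: ler_sum => m _; rewrite ler_wpM2l.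
  under [RHS]eq_bigr do rewrite mulr_sumr.
  rewrite [RHS]exchange_big; apply: eq_bigr => x _.
  under [RHS]eq_bigr do rewrite mulr_sumr.
  rewrite [RHS]exchange_big; apply: eq_bigr => y _.
  by rewrite /S /series /= mulr_sumr; apply: eq_bigr => m _; rewrite mulrCA.
Qed.

End CouplingMixtures.

Section Contraction.
Variables (R : realType) (T : finType) (X : chain R T).

Let Tsum (F : T -> R) : \sum_(i < #|T|) F (enum_val i) = \sum_x F x.
Proof.
rewrite (reindex (@enum_val T predT)) //; apply: onW_bij; exact: enum_val_bij.
Qed.

Definition lazy_mx (M : R) : 'M[R]_#|T| :=
  \matrix_(i, j) lazy X M (enum_val i) (enum_val j).

Definition lazy_evolve (M : R) (m : nat) (mu : T -> R) (y : T) : R :=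
  \sum_x mu x * (lazy_mx M ^+ m) (enum_rank x) (enum_rank y).

Lemma lazy_evolve0 M mu y : lazy_evolve M 0 mu y = mu y.
Proof.
rewrite /lazy_evolve -[RHS](sum_indic mu y); apply: eq_bigr => x _.
by rewrite expr0 mxE (inj_eq enum_rank_inj) mulrC.
Qed.

Lemma lazy_evolveS M m mu y :
  lazy_evolve M m.+1 mu y = \sum_x lazy_evolve M m mu x * lazy X M x y.
Proof.
rewrite /lazy_evolve; under [RHS]eq_bigr do rewrite mulr_suml.
rewrite exchange_big; apply: eq_bigr => x _.
rewrite exprSr mxE -Tsum mulr_sumr; apply: eq_bigr => k _.
by rewrite enum_valK mulrA; congr (_ * _); rewrite mxE enum_rankK.
Qed.

(** Shifting [tL] by the scalar [tM] gives [tM (1 + L/M)] and multiplies the exponential by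
    [e^(tM)]; the factor [expR (- (t * M))] undoes this. *)
Lemma semigroup_poisson (M t : R) x y : 0 < M -> 0 <= t ->
  (series (fun m => expR (- (t * M)) * exp_coeff (t * M) m *
      (lazy_mx M ^+ m) (enum_rank x) (enum_rank y)) @ \oo -->
   semigroup X t x y)%classic.
Proof.
move=> M0 t0; set s := t * M; have s0 : 0 <= s by rewrite mulr_ge0 // ltW.
have AE : t *: generator_mx X + s%:M = s *: lazy_mx M.
  apply/matrixP => i j; rewrite !mxE /lazy (inj_eq enum_val_inj) [j == i]eq_sym.
  rewrite /s mulrDr addrC mulr_natr; congr (_ + _).
  by field; rewrite gt_eqF.
have := @expmxD_scalar_cvg R _ (t *: generator_mx X) s (enum_rank x)
  (enum_rank y) s0.
rewrite AE => /(cvgMl_tmp (a := expR (- s))).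
rewrite [X in (_ --> X)%classic -> _]mulrCA -expRD addNr expR0 mulr1.
apply: eq_cvgn => N; rewrite /series /= mulr_sumr; apply: eq_bigr => m _.
rewrite -mulrA; congr (_ * _); rewrite mulrAC; congr (_ / _).
suff -> : (s *: lazy_mx M) ^+ m = s ^+ m *: lazy_mx M ^+ m by rewrite mxE.
elim: (m) => [|m' IHm]; first by rewrite !expr0 scale1r.
by rewrite !exprS IHm -[LHS]/(_ *m _) -scalemxAl -scalemxAr scalerA.
Qed.

Lemma evolve_poisson (M t : R) mu y : 0 < M -> 0 <= t ->
  (series (fun m => expR (- (t * M)) * exp_coeff (t * M) m * lazy_evolve M m mu y)
     @ \oo --> evolve X mu t y)%classic.
Proof.
move=> M0 t0.
have := @cvgn_sum R T _ _ (fun x =>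
  cvgMl_tmp (a := mu x) (@semigroup_poisson M t x y M0 t0)).
move=> /(_ _)/eq_cvgn; apply => N; rewrite /series /=.
under eq_bigr do rewrite mulr_sumr.
rewrite exchange_big; apply: eq_bigr => m _; rewrite mulr_sumr.
by apply: eq_bigr => x _; rewrite mulrCA.
Qed.

Definition cost (p : R) (g : T -> T -> R) : R :=
  \sum_x \sum_y ((gdist X x y)%:R `^ p) * g x y.

Variables (K M : R) (g : T -> T -> T -> T -> R).
Hypotheses (M0 : 0 < M) (KM : K <= M).
Hypothesis gP : forall x y, contracting_coupling X K M x y (gdist X x y) (g x y).

(** Multiplied by [M], the off-diagonal entries become jump rates and the diagonal ones serve as the
    free values [qx] and [qy]. The total mass becomes [M], and [M (1 - K/M) = M - K]. *)
Lemma contracting_Ric : Ric_cc_inf_ge X K.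
Proof.
move=> x y _; have [[g0 gl gr] gs gd] := gP x y.
have lazyE x' z : M * lazy X M x' z =
    if z == x' then M * lazy X M x' x' else jump_rate X x' z.
  case: eqVneq => [->//|zx]; rewrite /lazy (negbTE zx) add0r generator_indic //.
  by rewrite mulrC divfK // gt_eqF.
have lazy0 : 0 <= M * lazy X M x x.
  by rewrite mulr_ge0 ?(ltW M0) // -gl sumr_ge0.
have lazy0' : 0 <= M * lazy X M y y.
  by rewrite mulr_ge0 ?(ltW M0) // -gr sumr_ge0.
apply: ereal_sup_ubound; exists K => //; exists (fun v z => M * g x y v z); split.
- exists (M * lazy X M x x), (M * lazy X M y y); split=> // [v z|z|v].
  + by rewrite mulr_ge0 ?(ltW M0).
  + by rewrite -mulr_sumr gr lazyE.
  + by rewrite -mulr_sumr gl lazyE.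
- rewrite big1 // => v _; rewrite big1 // => z _.
  have := g0 v z; rewrite le_eqVlt => /predU1P[<-|/gs];
    first by rewrite mulr0 mul0r.
  by rewrite leqNgt => /negbTE ->; rewrite mulr0.
- have -> : \sum_v \sum_z M * g x y v z = M.
    under eq_bigr do rewrite -mulr_sumr.
    by rewrite -mulr_sumr; under eq_bigr do rewrite gl; rewrite sum_lazy mulr1.
  have -> : M - K = M * (1 - K / M).
    by rewrite mulrBr mulr1 mulrCA mulfV ?mulr1 // gt_eqF.
  rewrite -mulrA; apply: le_trans (ler_wpM2l (ltW M0) gd).
  rewrite mulr_sumr ler_sum // => v _; rewrite mulr_sumr ler_sum // => z _.
  by rewrite mulrA.
Qed.

(** On the support the distance does not increase, so the factor [d^(p-1)] is at most its initial
    value and only the mean of [d] remains to be bounded. *)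
Lemma contracting_cost p x y : 1 <= p ->
  cost p (g x y) <= (1 - K / M) * (gdist X x y)%:R `^ p.
Proof.
move=> p1; have [[g0 _ _] gs gd] := gP x y.
have powS (d : R) : 0 <= d -> d `^ p = d `^ (p - 1) * d.
  move=> d0; rewrite -{3}(powRr1 d0) -powRD ?subrK //.
  by rewrite (_ : (p == 0) = false) // gt_eqF // (lt_le_trans ltr01).
rewrite powS // mulrCA; apply: le_trans (ler_wpM2l (powR_ge0 _ _) gd).
rewrite mulr_sumr ler_sum // => v _; rewrite mulr_sumr ler_sum // => z _.
have := g0 v z; rewrite le_eqVlt => /predU1P[<-|gvz];
  first by rewrite mulr0 mul0r mulr0.
rewrite powS // -mulrA [X in _ * X <= _]mulrC ler_wpM2r ?mulr_ge0 //.
by apply: ge0_ler_powR; rewrite ?subr_ge0 // ?nnegrE // ler_nat gs.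
Qed.

(** Draw [(x, y)] from [h], then a joint step from [g x y], and average the pointwise
    contraction. *)
Lemma cost_step p mu nu h : 1 <= p -> is_coupling mu nu h ->
  exists2 h', is_coupling (fun z => \sum_x mu x * lazy X M x z)
                (fun z => \sum_x nu x * lazy X M x z) h' &
    cost p h' <= (1 - K / M) * cost p h.
Proof.
move=> p1 [h0 hl hr]; exists (fun v z => \sum_x \sum_y h x y * g x y v z).
  split=> [v z|v|z].
  - apply: sumr_ge0 => x _; apply: sumr_ge0 => y _; rewrite mulr_ge0 //.
    by have [[g0 _ _] _ _] := gP x y.
  - rewrite exchange_big; apply: eq_bigr => x _.
    rewrite exchange_big -hl mulr_suml; apply: eq_bigr => y _.
    by rewrite -mulr_sumr; have [[_ -> _] _ _] := gP x y.
  - rewrite exchange_big /=; under eq_bigr do rewrite exchange_big.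
    rewrite exchange_big; apply: eq_bigr => y _.
    rewrite -hr mulr_suml; apply: eq_bigr => x _.
    by rewrite -mulr_sumr; have [[_ _ ->] _ _] := gP x y.
rewrite (_ : cost p _ = \sum_x \sum_y h x y * cost p (g x y)).
  rewrite mulr_sumr ler_sum // => x _; rewrite mulr_sumr ler_sum // => y _.
  by rewrite [leRHS]mulrA [leRHS]mulrC ler_wpM2l // contracting_cost.
rewrite /cost.
under [RHS]eq_bigr do under eq_bigr do rewrite mulr_sumr.
under [RHS]eq_bigr do rewrite exchange_big.
rewrite [RHS]exchange_big; apply: eq_bigr => v _.
under [RHS]eq_bigr do under eq_bigr do rewrite mulr_sumr.
under [RHS]eq_bigr do rewrite exchange_big.
rewrite [RHS]exchange_big; apply: eq_bigr => z _.
rewrite mulr_sumr; apply: eq_bigr => x _; rewrite mulr_sumr;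
  apply: eq_bigr => y _.
by rewrite mulrCA.
Qed.

Lemma cost_iter p mu nu h m : 1 <= p -> is_coupling mu nu h ->
  exists2 h', is_coupling (lazy_evolve M m mu) (lazy_evolve M m nu) h' &
    cost p h' <= (1 - K / M) ^+ m * cost p h.
Proof.
move=> p1 ch; elim: m => [|m [h' ch' le_h']].
  rewrite expr0 mul1r; exists h => //.
  by rewrite (_ : lazy_evolve M 0 mu = mu) 1?(_ : lazy_evolve M 0 nu = nu) //;
    apply/funext => y; rewrite lazy_evolve0.
have [h2 ch2 le_h2] := cost_step p1 ch'; exists h2.
  rewrite (_ : lazy_evolve M m.+1 mu = fun z =>
    \sum_x lazy_evolve M m mu x * lazy X M x z).
    rewrite (_ : lazy_evolve M m.+1 nu = fun z =>
      \sum_x lazy_evolve M m nu x * lazy X M x z) //.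
    by apply/funext => y; rewrite lazy_evolveS.
  by apply/funext => y; rewrite lazy_evolveS.
(* Chaining the bounds uses [1 - K / M >= 0], that is, [K <= M]. *)
apply: le_trans le_h2 _; rewrite exprS -mulrA ler_wpM2l //.
by rewrite subr_ge0 ler_pdivrMr // mul1r.
Qed.

Lemma cost_evolve p t mu nu h : 1 <= p -> 0 <= t -> is_coupling mu nu h ->
  exists2 h', is_coupling (evolve X mu t) (evolve X nu t) h' &
    cost p h' <= expR (- (K * t)) * cost p h.
Proof.
move=> p1 t0 ch.
have [hm hmP] : exists hm : nat -> T -> T -> R, forall m,
    is_coupling (lazy_evolve M m mu) (lazy_evolve M m nu) (hm m) /\
    cost p (hm m) <= (1 - K / M) ^+ m * cost p h.
  suff /choice[f fP] : forall m, exists h',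
    is_coupling (lazy_evolve M m mu) (lazy_evolve M m nu) h' /\
    cost p h' <= (1 - K / M) ^+ m * cost p h by exists f.
  by move=> m; have [h' ? ?] := cost_iter m p1 ch; exists h'.
apply: (@coupling_mixture _ _ (fun m => expR (- (t * M)) * exp_coeff (t * M) m)
  (fun m => lazy_evolve M m mu) (fun m => lazy_evolve M m nu) hm
  (fun m => (1 - K / M) ^+ m * cost p h)).
- by move=> m; rewrite mulr_ge0 ?expR_ge0 // exp_coeff_ge0 // mulr_ge0 // ltW.
- by move=> m; have [] := hmP m.
- by move=> m; have [] := hmP m.
- by move=> x; exact: evolve_poisson.
- by move=> x; exact: evolve_poisson.
(* The Poisson average of [(1 - K / M) ^+ m] is an exponential series in [t * M * (1 - K / M)]. *)
- have -> : expR (- (K * t)) * cost p h =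
      expR (- (t * M)) * cost p h * expR (t * M * (1 - K / M)).
    rewrite mulrAC -expRD; congr (expR _ * _).
    by field; rewrite gt_eqF.
  have := cvgMl_tmp (a := expR (- (t * M)) * cost p h)
    (is_cvg_series_exp_coeff (t * M * (1 - K / M))).
  move=> /(_ _)/eq_cvgn; apply => N; rewrite /series /= mulr_sumr.
  by apply: eq_bigr => m _; rewrite /exp_coeff /= [in LHS]exprMn; ring.
Qed.

Lemma contracting_Wp : Wp_contraction X K.
Proof.
move=> mu nu p t [mu0 mu1] [nu0 nu1] p1 t0.
have p0 : 0 < p by rewrite (lt_le_trans ltr01).
pose costs mu nu : set R :=
  [set r : R | exists2 h, is_coupling mu nu h & r = cost p h]%classic.
have WpE mu' nu' : Wp X p mu' nu' = inf (costs mu' nu') `^ p^-1 by [].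
have costs_ge0 mu' nu' r : costs mu' nu' r -> 0 <= r.
  case=> h [h0 _ _] ->; apply: sumr_ge0 => x _; apply: sumr_ge0 => y _.
  by rewrite mulr_ge0 ?powR_ge0.
(* The product coupling; nonemptiness matters because [inf] of the empty set is 0. *)
have costs_n0 : (costs mu nu !=set0)%classic.
  exists (cost p (fun x y => mu x * nu y)), (fun x y => mu x * nu y) => //; split.
  - by move=> x y; rewrite mulr_ge0.
  - by move=> x; rewrite -mulr_sumr nu1 mulr1.
  - by move=> y; rewrite -mulr_suml mu1 mul1r.
have inf0 : 0 <= inf (costs mu nu).
  by apply: lb_le_inf => // r; exact: costs_ge0.
have inf0' : 0 <= inf (costs (evolve X mu t) (evolve X nu t)).
  have [_ [h ch _]] := costs_n0; have [h' ch' _] := cost_evolve p1 t0 ch.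
  by apply: lb_le_inf => [|r]; [exists (cost p h'), h' | exact: costs_ge0].
(* Each coupling of [mu] and [nu] is carried forward by [cost_evolve]; the infimum is then taken
   over all of them. *)
have le_inf : inf (costs (evolve X mu t) (evolve X nu t)) <=
    expR (- (K * t)) * inf (costs mu nu).
  rewrite -ler_pdivrMl ?expR_gt0 //; apply: lb_le_inf => // _ [h ch ->].
  rewrite ler_pdivrMl ?expR_gt0 //; have [h' ch' le_h'] := cost_evolve p1 t0 ch.
  apply: le_trans le_h'; apply: ge_inf; last by exists h'.
  by exists 0 => r; exact: costs_ge0.
rewrite !WpE.
apply: (@le_trans _ _ ((expR (- (K * t)) * inf (costs mu nu)) `^ p^-1)).
  apply: ge0_ler_powR => //; rewrite ?nnegrE ?invr_ge0 ?(ltW p0) //.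
  by rewrite mulr_ge0 ?expR_ge0.
rewrite powRM ?expR_ge0 // -expRM.
by rewrite (_ : - (K * t) * p^-1 = - (K / p) * t) //; ring.
Qed.

End Contraction.

Theorem jump_coupling_contraction (R : realType) (T : finType)
    (X : chain R T) (K : R) :
  irreducible_chain X -> (forall x y, adj X x y -> jump_coupling X K x y) ->
  Ric_cc_inf_ge X K /\ Wp_contraction X K.
Proof.
move=> irr jc; have [M [M0 KM cc]] := contracting_coupling_exists irr jc.
have [g gP] : exists g : T -> T -> T -> T -> R, forall x y,
    contracting_coupling X K M x y (gdist X x y) (g x y).
  have /choice[f fP] : forall x, exists gx, forall y,
      contracting_coupling X K M x y (gdist X x y) (gx y).
    by move=> x; have /choice[f fP] := cc x; exists f.
  by exists f.
by split; [exact: contracting_Ric gP | exact: contracting_Wp gP].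
Qed.

(** * Moves and adjacency *)

Section Moves.
Variables (R : realType) (T : finType) (X : chain R T).

Lemma adj_act x (s : moves X) : 0 < rate x s ->
  (x == act s x) || adj X x (act s x).
Proof.
move=> r0; rewrite /adj /=; case: eqVneq => //= _.
rewrite /jump_rate (bigD1 s) //= ltr_pwDl //.
by apply: sumr_ge0 => ? _; exact: rate_ge0.
Qed.

Lemma adj_move x y : adj X x y -> exists2 s : moves X, act s x = y & 0 < rate x s.
Proof.
case/andP=> _; rewrite lt0r psumr_neq0; last by move=> s _; exact: rate_ge0.
by case/andP=> /hasP[s _ /andP[/eqP sx r0]] _; exists s.
Qed.

End Moves.

(** * Glauber dynamics *)

Section Glauber.
Variables (R : realType) (T : finType) (G : {set {ffun T -> T}}).
Variables (H : T -> R) (beta : R).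
Let c := glauber_rate H beta.
Let X := glauber G H beta.
Let kappa := glauber_kappa G H beta.

Lemma glauber_generatorE psi x :
  generator X psi x = \sum_(g in G) c x g * (psi (g x) - psi x).
Proof.
exact: (esym (big_sub (fun g => g \in G)
  (fun g : {ffun T -> T} => c x g * (psi (g x) - psi x)))).
Qed.

Lemma glauber_adj x g : g \in G -> (x == g x) || adj X x (g x).
Proof.
by move=> gG; apply: (@adj_act _ _ X x (exist _ g gG)); exact: expR_gt0.
Qed.

Hypothesis comm : forall x s g, s \in G -> g \in G ->
  [/\ s (g x) = g (s x), s (s x) = x & 0 <= kappa x s].

(* The move [s] joining the two configurations is kept in reserve: the part of a
   rate [c x g] exceeding [c (s x) g] is coupled with the copy at [s x] jumping
   back to [x], and symmetrically, so that [kappa x s] and [kappa (s x) s] are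
   the rates left for the two merging jumps. *)
Lemma glauber_jump_coupling x s : s \in G ->
  jump_coupling X (kappa x s + kappa (s x) s) x (s x).
Proof.
move=> sG; have [_ ssx _] := comm x sG sG.
have k0 u : 0 <= kappa u s by have [] := comm u sG sG.
set y := s x in ssx *.
pose F := {ffun T -> T}; pose d (u v : T) g : R := Num.max (- (c v g - c u g)) 0.
have d0 u v g : 0 <= d u v g by rewrite le_max lexx orbT.
have dE u v g : Num.min (c u g) (c v g) + d u v g = c u g.
  by rewrite /d opprB; case: leP => ?; case: leP => ?; lra.
have dE' u v g : Num.min (c u g) (c v g) + d v u g = c v g by rewrite minC dE.
(* Read as a budget: the return of [y] along [s] pays for the excess rates of [x] and leaves
   [kappa x s] for merging at [x]. *)
have kxE : c y s = kappa x s + \sum_(g in G | g != s) d x y g.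
  by rewrite /kappa /glauber_kappa subrK.
have kyE : c x s = kappa y s + \sum_(g in G | g != s) d y x g.
  by rewrite /kappa /glauber_kappa ssx subrK.
pose P g := (g \in G) && (g != s).
(* The four groups: both copies use [g]; [x] uses [g] while [y] returns to [x]; [x] goes to [y]
   while [y] uses [g]; the copies merge at [x] or at [y]. *)
pose w (i : (F + F) + (F + bool)) : R := match i with
  | inl (inl g) => (P g)%:R * Num.min (c x g) (c y g)
  | inl (inr g) => (P g)%:R * d x y g
  | inr (inl g) => (P g)%:R * d y x g
  | inr (inr b) => if b then kappa x s else kappa y s end.
pose a (i : (F + F) + (F + bool)) : T := match i with
  | inl (inl g) => g x | inl (inr g) => g x
  | inr (inl g) => y | inr (inr b) => if b then x else y end.
pose b (i : (F + F) + (F + bool)) : T := match i with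
  | inl (inl g) => g y | inl (inr g) => x
  | inr (inl g) => g y | inr (inr b) => if b then x else y end.
have sumP (f h : F -> R) :
    \sum_g (P g)%:R * f g * h g = \sum_(g in G | g != s) f g * h g.
  rewrite [RHS]big_mkcond; apply: eq_bigr => g _; rewrite -/(P g).
  by case: (P g); rewrite ?mul1r ?mul0r.
have sumE (f : _ -> R) : \sum_i w i * f i =
  \sum_(g in G | g != s) (Num.min (c x g) (c y g) * f (inl (inl g)) +
     d x y g * f (inl (inr g)) + d y x g * f (inr (inl g))) +
  (kappa x s * f (inr (inr true)) + kappa y s * f (inr (inr false))).
  by rewrite !big_sumType /= !sumP big_bool /= !big_split /= !addrA.
exists _, w, a, b; split.
- move=> [[g|g]|[g|[]]] //=; rewrite mulr_ge0 //.
  by rewrite le_min /c /glauber_rate !expR_ge0.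
- move=> psi; rewrite sumE /= glauber_generatorE [RHS](bigD1 s) //= -/y kyE.
  rewrite subrr mulr0 add0r [X in _ = X + _]mulrDl mulr_suml.
  rewrite [X in _ = X + _]addrC addrAC -big_split; congr (_ + _).
  by apply: eq_bigr => g _; rewrite /= -[in RHS](dE x y g); ring.
- move=> psi; rewrite sumE /= glauber_generatorE [RHS](bigD1 s) //= ssx kxE.
  rewrite subrr mulr0 addr0 [X in _ = X + _]mulrDl mulr_suml.
  rewrite [X in _ = X + _]addrC addrAC -big_split; congr (_ + _).
  by apply: eq_bigr => g _; rewrite /= -[in RHS](dE' x y g); ring.
- have PG g (r : R) : 0 < (P g)%:R * r -> g \in G.
    by rewrite /P; case: (g \in G); rewrite ?mul0r ?ltxx.
  move=> [[g|g]|[g|[]]] //=; rewrite ?eqxx // => /PG gG.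
  + by have [<- _ _] := comm x sG gG; rewrite glauber_adj.
  + by have [_ ggx _] := comm x gG gG; rewrite -{2 4}ggx glauber_adj.
  + by rewrite glauber_adj.
- rewrite sumE /= !eqxx !mulr1 lerDr sumr_ge0 // => g _.
  by rewrite !addr_ge0 // mulr_ge0 // le_min /c /glauber_rate !expR_ge0.
Qed.

(** Nonnegativity of [kappa] bounds the set below by 0, so its real infimum is a genuine lower
    bound. *)
Lemma glauber_kappa_star_le x s : s \in G ->
  glauber_kappa_star G H beta <= kappa x s + kappa (s x) s.
Proof.
move=> sG; apply: ge_inf; last by exists x, s.
exists 0 => _ [u [g [gG ->]]]; have [_ _ k0] := comm u gG gG.
by have [_ _ k1] := comm (g u) gG gG; rewrite addr_ge0.
Qed.

Theorem glauber_contraction : irreducible_chain X ->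
  Ric_cc_inf_ge X (glauber_kappa_star G H beta) /\
  Wp_contraction X (glauber_kappa_star G H beta).
Proof.
move=> irr; apply: jump_coupling_contraction => // x y /adj_move[[s sG] /= <- _].
have [I [w [a [b [w0 wa wb wadj le_w]]]]] := glauber_jump_coupling x sG.
by exists I, w, a, b; split=> //; apply: le_trans le_w;
  exact: glauber_kappa_star_le.
Qed.

End Glauber.

(** * Bernoulli-Laplace model *)

Lemma sum_option (R : nmodType) (I : finType) (F : option I -> R) :
  \sum_o F o = F None + \sum_i F (Some i).
Proof.
rewrite (bigD1 None) //=; congr (_ + _).
rewrite (reindex_omap Some id) //=; last by case.
by apply: eq_bigl => i; rewrite eqxx.
Qed.

Section BernoulliLaplace.
Variables (R : realType) (L N : nat).
Let X := bernoulli_laplace R L N.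
Implicit Types (x y : bl_state L N) (i j k l : 'I_L).

Lemma val_bl_move x i j u : val x i -> ~~ val x j ->
  val (bl_move (i, j) x) u = (u == j) || (u != i) && val x u.
Proof.
move=> xi xj; have /= := @bl_moveE L N (i, j) x xi xj u.
(* Parity turns the counting identity into one between booleans. *)
move=> /(congr1 odd); rewrite !oddD !oddb.
have [->|uj] := eqVneq u j.
  have -> : (j == i) = false by apply: contraNF xj => /eqP ->.
  by rewrite (negbTE xj) addbF.
have [->|ui] := eqVneq u i; last by rewrite !addbF.
by rewrite xi addbT addbF => /negbRL.
Qed.

Lemma bl_rateE x i j : bl_rate R x (i, j) = (val x i && ~~ val x j)%:R.
Proof.
rewrite /bl_rate /=.
by do 2 case: (val x _); rewrite ?subrr ?subr0 ?mulr0 ?mulr1 ?mul0r.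
Qed.

Lemma bl_state_ext x y : (forall u, val x u = val y u) -> x = y.
Proof. by move=> xy; apply/val_inj/ffunP. Qed.

Lemma bl_adj_move x i j : val x i -> ~~ val x j ->
  (x == bl_move (i, j) x) || adj X x (bl_move (i, j) x).
Proof.
by move=> xi xj; apply: (@adj_act _ _ X x (i, j)); rewrite /= bl_rateE xi xj.
Qed.

(** Induction on the number of sites occupied in [x] only. Equal particle numbers provide a site
    occupied in [y] only, and moving a particle there lowers the count. *)
Lemma bl_irreducible : irreducible_chain X.
Proof.
move=> x y; have [n] := ubnP #|[set u | val x u && ~~ val y u]|.
elim: n x => // n IHn x le_n.
case: (pickP [pred u | val x u && ~~ val y u]) => /= [i /andP[xi yi]|xy].
  have [j /andP[xj yj]] : exists j, ~~ val x j && val y j.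
    apply/existsP; rewrite -[X in is_true X]negbK negb_exists.
    apply/negP => /forallP yx.
    have : (\sum_u val y u < \sum_u val x u)%N.
      rewrite (bigD1 i) //= [ltnRHS](bigD1 i) //= xi (negbTE yi).
      rewrite add0n add1n ltnS leq_sum // => u _.
      by have := yx u; case: (val x u); case: (val y u).
    by rewrite (eqP (valP x)) (eqP (valP y)) ltnn.
  have xx' : connect (adj X) x (bl_move (i, j) x).
    by case/orP: (bl_adj_move xi xj) => [/eqP <-|/connect1].
  apply: connect_trans xx' (IHn _ _); rewrite ltnS in le_n.
  apply: leq_trans _ le_n; apply: proper_card; apply/properP; split.
    apply/fintype.subsetP => u; rewrite !inE val_bl_move // => /andP[+ yu];
      rewrite yu andbT.
    by case/orP=> [/eqP uj|/andP[] //]; rewrite uj yj in yu.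
  by exists i; rewrite !inE ?xi ?yi // val_bl_move // eqxx orbF andbT;
    apply: contra xj => /eqP <-.
suff -> : x = y by [].
have le_u u : (val x u <= val y u)%N.
  by have := xy u => /=; case: (val x u); case: (val y u).
apply: bl_state_ext => u; apply/eqP; apply: contraT => xyu.
have : (\sum_u val x u < \sum_u val y u)%N.
  rewrite (bigD1 u) //= [ltnRHS](bigD1 u) //= -addSn leq_add ?leq_sum //.
  by have := le_u u; move: xyu; case: (val x u); case: (val y u).
by rewrite (eqP (valP x)) (eqP (valP y)) ltnn.
Qed.

(* Conjugating by the transposition of [i] and [j] turns the moves of [x] into
   those of [y]. The jump of [x] along [(i, j)] and that of [y] along [(j, i)]
   are performed separately. *)
Lemma bl_jump_coupling x i j : val x i -> ~~ val x j ->
  jump_coupling X L%:R x (bl_move (i, j) x).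
Proof.
move=> xi xj; set y := bl_move (i, j) x.
have ij : i != j by apply: contraNneq xj => <-.
have yE u : val y u = (u == j) || (u != i) && val x u by rewrite val_bl_move.
have yi : ~~ val y i by rewrite yE (negbTE ij) eqxx.
have yj : val y j by rewrite yE eqxx.
have yx : bl_move (j, i) y = x.
  apply: bl_state_ext => u; rewrite val_bl_move // yE.
  have [->|ui] := eqVneq u i; first by rewrite xi.
  by have [->|uj] := eqVneq u j; rewrite //= (negbTE xj).
pose t := tperm i j.
have yt u : val y (t u) = val x u.
  rewrite /t yE; case: tpermP => [->|->|/eqP ui /eqP uj].
  - by rewrite eqxx xi.
  - by rewrite (negbTE ij) eqxx (negbTE xj).
  - by rewrite (negbTE uj) ui.
(* [None] is the jump of [y] back to [x] while [x] rests; at [Some (i, j)], [x] jumps to [y] while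
   [y] rests. Any other move is paired with its conjugate by [t]. *)
pose w (o : option ('I_L * 'I_L)) : R := if o is Some m then bl_rate R x m else 1.
pose a (o : option ('I_L * 'I_L)) := if o is Some m then bl_move m x else x.
pose b (o : option ('I_L * 'I_L)) :=
  if o is Some m then if m == (i, j) then y else bl_move (t m.1, t m.2) y else x.
(* If [x] moves its particle at [i] to [l], then [y] moves the one at [j] to [l], and the
   discrepancy disappears. Filling [j] in [x] and [i] in [y] from a common site [k] has the same
   effect. *)
have mergei l : ~~ val x l -> bl_move (i, l) x = b (Some (i, l)).
  move=> xl; rewrite /b; case: eqVneq => [[->]//|il].
  have lj : l != j by apply: contraNneq il => ->.
  have li : l != i by apply: contraNneq xl => ->.
  rewrite /= /t tpermL tpermD 1?eq_sym //; apply: bl_state_ext => u.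
  rewrite !val_bl_move // ?yE ?(negbTE lj) ?li ?eqxx //.
  by have [->|] := eqVneq u j; rewrite ?(negbTE xj) ?andbF ?orbF.
have mergej k : k != i -> val x k -> bl_move (k, j) x = b (Some (k, j)).
  move=> ki xk; rewrite /b; case: eqVneq => [[]|_]; first by move/eqP: ki.
  have kj : k != j by apply: contraNneq xj => <-.
  rewrite /= /t tpermR tpermD 1?eq_sym //; apply: bl_state_ext => u.
  rewrite !val_bl_move // ?yE ?(negbTE ij) ?(negbTE kj) ?ki ?eqxx //.
  have [->|ui] := eqVneq u i; first by rewrite xi [i == k]eq_sym ki orbT.
  by have [->|uj] := eqVneq u j; rewrite // [j == k]eq_sym kj.
exists _, w, a, b; split.
- by case=> [m|] //; exact: bl_rate_ge0.
- by move=> psi; rewrite sum_option /= subrr mulr0 add0r.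
- move=> psi; rewrite sum_option /= mul1r.
  rewrite [RHS](reindex (fun m => (t m.1, t m.2))) /=; last first.
    by exists (fun m => (t m.1, t m.2)) => -[k l] _ /=; rewrite /t !tpermK.
  rewrite (bigD1 (i, j)) // [RHS](bigD1 (i, j)) //= eqxx subrr mulr0 add0r.
  rewrite /t tpermL tpermR yx bl_rateE yj yi mul1r; congr (_ + _).
  apply: eq_bigr => -[k l] /negbTE klij; rewrite klij; congr (_ * _).
  by rewrite !bl_rateE !yt.
- case=> [[k l]|] /=; last by rewrite eqxx.
  rewrite bl_rateE; case: (boolP (val x k)) => [xk|_]; last by rewrite ltxx.
  case: (boolP (val x l)) => [_|xl _]; first by rewrite ltxx.
  have [ki|ki] := eqVneq k i; first by rewrite ki (mergei _ xl) eqxx.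
  have [lj|lj] := eqVneq l j; first by rewrite lj (mergej _ ki xk) eqxx.
  have kj : k != j by apply: contraNneq xj => <-.
  have li : l != i by apply: contraNneq xl => ->.
  rewrite [(k, l) == _]xpair_eqE (negbTE ki) /=.
  rewrite /t !tpermD 1?eq_sym //.
  (* A move touching neither [i] nor [j] commutes with [(i, j)], so the copies still differ by that
     single move. *)
  have -> : bl_move (k, l) y = bl_move (i, j) (bl_move (k, l) x).
    apply: bl_state_ext => u.
    rewrite !val_bl_move // ?yE ?val_bl_move ?(negbTE kj) ?ki ?(negbTE lj) ?li
      //=.
    + have [->|uj] := eqVneq u j;
        first by rewrite [j == l]eq_sym (negbTE lj) /= [j == k]eq_sym kj.
      have [->|ui] := eqVneq u i;
        first by rewrite [i == l]eq_sym (negbTE li) andbF.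
      by [].
    + by rewrite [i == k]eq_sym ki xi orbT.
    + by rewrite (negbTE xj) andbF orbF eq_sym.
  rewrite eq_sym; apply: bl_adj_move; rewrite val_bl_move //;
    first by rewrite [i == k]eq_sym ki xi orbT.
  by rewrite (negbTE xj) andbF orbF eq_sym.
(* Merging rates: 1 from [None], [L - N] from the moves out of [i], and [N - 1] from the other moves
   into [j]; together [L]. *)
- rewrite sum_option /= eqxx mulr1.
  have /le_trans : L%:R <= 1 + \sum_k \sum_l ((k == i)%:R * (1 - (val x l)%:R)
      + ((l == j)%:R * ((k != i)%:R * (val x k)%:R)) : R).
    under eq_bigr do rewrite big_split /= sum_indic -mulr_sumr.
    rewrite big_split /= -mulr_suml sum_indic1 mul1r sumrB.
    rewrite [X in _ - X + _](bigD1 i) //= xi sumr_const card_ord.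
    rewrite [X in _ <= _ + (_ + X)](bigD1 i) //= eqxx mul0r add0r.
    rewrite [X in _ <= 1 + (_ + X)](eq_bigr (fun k => (val x k)%:R)); last first.
      by move=> k ->; rewrite mul1r.
    by rewrite [true%:R]mulr1n; lra.
  apply; rewrite lerD2l pair_big /= ler_sum // => -[k l] _ /=.
  rewrite bl_rateE; have [->|ki] := eqVneq k i; rewrite /=.
    rewrite mul0r mulr0 addr0 mul1r xi; case: (boolP (val x l)) => [_|xl];
      first by rewrite subrr mul0r.
    by rewrite subr0 (mergei _ xl) eqxx mulr1.
  rewrite !mul0r add0r mul1r; have [->|lj] := eqVneq l j; last first.
    by rewrite mul0r mulr_ge0.
  by rewrite mul1r xj; case: (boolP (val x k)) => [xk|_];
    rewrite ?mul0r // (mergej _ ki xk) eqxx mulr1.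
Qed.

Theorem bl_contraction : Ric_cc_inf_ge X L%:R /\ Wp_contraction X L%:R.
Proof.
apply: jump_coupling_contraction => [|x y /adj_move[[i j] /= <-]];
  first exact: bl_irreducible.
rewrite bl_rateE; case: (boolP (val x i)) => [xi|_]; last by rewrite ltxx.
by case: (boolP (val x j)) => [_|xj _]; [rewrite ltxx | exact: bl_jump_coupling].
Qed.

End BernoulliLaplace.

(** * Hardcore model *)

(** Reduces the hardcore model to pairs whose second configuration has the extra particle. *)
Lemma jump_coupling_sym (R : realType) (T : finType) (X : chain R T) (K : R) x y :
  symmetric (adj X) -> jump_coupling X K x y -> jump_coupling X K y x.
Proof.
move=> sym [I [w [a [b [w0 wa wb wadj wK]]]]]; exists I, w, b, a; split=> //.
  by move=> i /wadj; rewrite eq_sym sym.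
by under eq_bigr do rewrite eq_sym.
Qed.

Section Hardcore.
Variables (R : realType) (V : finType) (e : rel V).
Variables (beta : R) (beta_gt0 : 0 < beta).
Hypothesis e_sym : symmetric e.
Hypothesis e_irr : irreflexive e.
Let X := hardcore e beta_gt0.
Implicit Types (x y : hc_state e) (u v : V).

Definition hc_free x u := [forall v, (v == u) || e u v ==> ~~ val x v].

Lemma hc_freeP x u :
  reflect (~~ val x u /\ forall v, e u v -> ~~ val x v) (hc_free x u).
Proof.
apply: (iffP forallP) => [free|[xu xN] v].
  split=> [|v uv]; first by have := free u; rewrite eqxx.
  by have := free v; rewrite uv orbT.
by apply/implyP => /orP[/eqP ->|/xN].
Qed.

Lemma hc_excl x u v : e u v -> val x u -> ~~ val x v.
Proof.
by move=> uv xu; have /forallP/(_ u)/forallP/(_ v) := valP x; rewrite uv xu.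
Qed.

Lemma hc_state_ext x y : (forall u, val x u = val y u) -> x = y.
Proof. by move=> xy; apply/val_inj/ffunP. Qed.

Lemma hc_rate_add x u : hc_rate beta x (u, true) = beta * (hc_free x u)%:R.
Proof.
rewrite /hc_rate /=; congr (_ * _).
case: (boolP (hc_free x u)) => [/forallP free|].
  by rewrite big1 // => v vu; have := free v; rewrite vu => /negbTE ->;
    rewrite subr0.
rewrite negb_forall => /existsP[v]; rewrite negb_imply negbK => /andP[vu xv].
by rewrite (bigD1 v) //= xv subrr mul0r.
Qed.

Lemma val_hc_add x u v : hc_free x u ->
  val (hc_move (u, true) x) v = (v == u) || val x v.
Proof.
move=> /hc_freeP[xu xN]; rewrite /hc_move val_insubd ifT ?ffunE //.
apply/forallP => k; apply/forallP => l; apply/implyP => kl;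
  rewrite !ffunE negb_and /=.
have [ku|_] := eqVneq k u.
  rewrite ku in kl; rewrite (negbTE (xN _ kl)) orbF /=.
  by apply: contraTneq kl => ->; rewrite e_irr.
have [lu|_] := eqVneq l u; first by rewrite orbF; apply: xN; rewrite -lu e_sym.
by rewrite -negb_and; have /forallP/(_ k)/forallP/(_ l) := valP x; rewrite kl.
Qed.

Lemma val_hc_del x u v : val (hc_move (u, false) x) v = (v != u) && val x v.
Proof.
rewrite /hc_move val_insubd ifT ?ffunE //.
apply/forallP => k; apply/forallP => l; apply/implyP => kl; rewrite !ffunE /=.
have /forallP/(_ k)/forallP/(_ l) := valP x; rewrite kl /=.
by apply: contra => /andP[/andP[_ ->] /andP[_ ->]].
Qed.

Lemma hc_del_id x u : ~~ val x u -> hc_move (u, false) x = x.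
Proof.
move=> xu; apply: hc_state_ext => v; rewrite val_hc_del.
by have [->|] := eqVneq v u; rewrite ?(negbTE xu).
Qed.

Lemma hc_addK x u : hc_free x u -> hc_move (u, false) (hc_move (u, true) x) = x.
Proof.
move=> free; have /hc_freeP[xu _] := free; apply: hc_state_ext => v.
by rewrite val_hc_del val_hc_add //; have [->|] := eqVneq v u;
  rewrite ?(negbTE xu).
Qed.

Lemma hc_free_del x u : val x u -> hc_free (hc_move (u, false) x) u.
Proof.
move=> xu; apply/hc_freeP; split=> [|v uv]; rewrite val_hc_del ?eqxx //.
by rewrite (negbTE (hc_excl uv xu)) andbF.
Qed.

Lemma hc_delK x u : val x u -> hc_move (u, true) (hc_move (u, false) x) = x.
Proof.
move=> xu; apply: hc_state_ext => v;
  rewrite val_hc_add ?hc_free_del // val_hc_del.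
by have [->|] := eqVneq v u.
Qed.

Lemma hc_adj_add x u : hc_free x u -> adj X x (hc_move (u, true) x).
Proof.
move=> free; have /hc_freeP[xu _] := free.
have : 0 < hc_rate beta x (u, true) by rewrite hc_rate_add free mulr1.
move=> /(@adj_act _ _ X x (u, true))/orP[/eqP xE|//].
by have := val_hc_add u free; rewrite -[hc_move _ _]xE eqxx (negbTE xu).
Qed.

Lemma hc_adj_del x u : val x u -> adj X x (hc_move (u, false) x).
Proof.
move=> xu; have : 0 < hc_rate beta x (u, false) by rewrite /hc_rate /= xu.
move=> /(@adj_act _ _ X x (u, false))/orP[/eqP xE|//].
by have := val_hc_del x u u; rewrite -[hc_move _ _]xE eqxx xu.
Qed.

Lemma hc_adjP x y : adj X x y -> exists u,
  hc_free x u /\ y = hc_move (u, true) x \/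
  hc_free y u /\ x = hc_move (u, true) y.
Proof.
case/adj_move=> -[u [|]] /= <- r0; exists u; [left|right].
  by move: r0; rewrite hc_rate_add; case: (hc_free x u) => //; rewrite mulr0 ltxx.
have xu : val x u.
  by move: r0; rewrite /hc_rate /=; case: (val x u); rewrite ?ltxx.
by rewrite hc_free_del ?hc_delK.
Qed.

Lemma hc_adj_sym : symmetric (adj X).
Proof.
suff sub x y : adj X x y -> adj X y x by move=> x y; apply/idP/idP; exact: sub.
case/hc_adjP=> u [[free ->]|[free ->]]; last exact: hc_adj_add.
by rewrite -{2}(hc_addK free) hc_adj_del // val_hc_add // eqxx.
Qed.

(** Deleting particles leads every configuration to the empty one, and adjacency is symmetric. *)
Lemma hc_irreducible : irreducible_chain X.
Proof.
pose card x := #|[set u | val x u]|.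
suff conn x y : card x = 0%N -> connect (adj X) y x.
  have [z z0] : exists z, card z = 0%N.
    pose z : {ffun V -> bool} := [ffun=> false].
    have z_hc : [forall k, forall l, e k l ==> ~~ (z k && z l)].
      by apply/forallP => k; apply/forallP => l; rewrite !ffunE implybT.
    exists (Sub z z_hc : hc_state e); apply/eqP; rewrite cards_eq0;
      apply/eqP/setP => u.
    by rewrite !inE SubK ffunE.
  move=> x y; apply: connect_trans (conn _ _ z0) _.
  by rewrite (sym_connect_sym hc_adj_sym) conn.
move=> x0; have [n] := ubnP (card y); elim: n y => // n IHn y le_n.
case: (pickP (val y)) => [u yu|y0].
  apply: connect_trans (connect1 (hc_adj_del yu)) (IHn _ _).
  rewrite ltnS in le_n; apply: leq_trans _ le_n; apply: proper_card;
    apply/properP; split.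
    by apply/fintype.subsetP => v; rewrite !inE val_hc_del => /andP[].
  by exists u; rewrite !inE // val_hc_del eqxx.
suff -> : y = x by [].
apply: hc_state_ext => u; rewrite y0; move/eqP: x0;
  rewrite cards_eq0 => /eqP/setP/(_ u).
by rewrite !inE.
Qed.

Hypothesis small : beta * (max_degree e)%:R <= 1.

(* The copy at [y] = [x] + [u] cannot fill a neighbour [v] of [u]; while the copy
   at [x] does so, [y] removes [u], which uses up rate [S <= 1] of this removal. *)
Lemma hc_jump_coupling x u : hc_free x u ->
  jump_coupling X (1 - beta * ((max_degree e)%:R - 1)) x (hc_move (u, true) x).
Proof.
move=> free; set y := hc_move (u, true) x; have /hc_freeP[xu xN] := free.
have yE v : val y v = (v == u) || val x v by rewrite val_hc_add.
(* The total rate at which [x] fills neighbours of [u]: at most [max_degree e] sites, each at rate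
   at most [beta]. *)
pose S := \sum_v (e u v)%:R * hc_rate beta x (v, true).
have leS : S <= beta * (max_degree e)%:R.
  apply: (@le_trans _ _ (beta * (#|[set v | e u v]|)%:R)); last first.
    rewrite ler_pM2l // ler_nat; apply: leq_trans (bigop.leq_bigmax u).
    (* [max_degree] counts a classical set, converted here to the finite set of neighbours. *)
    by apply/eq_leq/eq_card => v; rewrite inE;
      apply/idP/idP => [/mem_set|/set_mem].
  rewrite -sum1_card natr_sum mulr_sumr [leRHS]big_mkcond ler_sum //= => v _.
  rewrite inE hc_rate_add; case: (e u v); last by rewrite mul0r.
  by rewrite mul1r ler_pM2l // lern1 leq_b1.
have freeE v : v != u -> ~~ e u v -> hc_free y v = hc_free x v.
  move=> vu uv; rewrite /hc_free; apply: eq_forallb => k; rewrite yE.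
  have [->|//] := eqVneq k u.
  by rewrite eq_sym (negbTE vu) e_sym (negbTE uv).
have yfree v : (v == u) || e u v -> hc_free y v = false.
  move=> vu; apply/negbTE/negP => /hc_freeP[yv yN]; case/orP: vu => [/eqP vu|uv].
    by rewrite yE vu eqxx in yv.
  by have := yN u; rewrite e_sym => /(_ uv); rewrite yE eqxx.
pose w (m : V * bool) : R :=
  if ~~ m.2 && (m.1 == u) then 1 - S else hc_rate beta x m.
pose b (m : V * bool) := if m.2 then
    if m.1 == u then y else if e u m.1 then x else hc_move m y
  else hc_move m y.
exists _, w, (fun m => hc_move m x), b; split.
- move=> m; rewrite /w; case: ifP => _; last exact: hc_rate_ge0.
  by rewrite subr_ge0 (le_trans leS).
- move=> psi; rewrite /generator; apply: eq_bigr => -[v c] _; rewrite /w /=.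
  case: ifP => // /andP[cF /eqP ->].
  by rewrite (negbTE cF) hc_del_id // subrr !mulr0.
(* [corr] transfers rate [S] from the removal of [u] to the fillings of its neighbours. Both send
   [y] to [x], so the generator at [y] is unchanged. *)
- move=> psi; rewrite /generator; pose corr (m : V * bool) : R :=
    if m.2 then (e u m.1)%:R * hc_rate beta x m else (m.1 == u)%:R * - S.
  have corr0 : \sum_m corr m = 0.
    rewrite -(pair_bigA _ (fun v c => corr (v, c))) /=.
    under eq_bigr do rewrite big_bool /=.
    by rewrite big_split /= sum_indic subrr.
  rewrite -[RHS]addr0 -[X in _ = _ + X](mul0r (psi x - psi y)).
  rewrite -[X in _ = _ + X * _]corr0 mulr_suml -big_split /=.
  apply: eq_bigr => -[v [|]] _; rewrite /w /b /corr /=.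
    have [->|vu] := eqVneq v u.
      by rewrite e_irr subrr mulr0 !mul0r addr0 hc_rate_add yfree ?eqxx //
        mulr0 mul0r.
    case: (boolP (e u v)) => uv.
      by rewrite mul1r [X in _ = X * _ + _]hc_rate_add yfree ?uv ?orbT // mulr0
        mul0r add0r.
    by rewrite !mul0r addr0 !hc_rate_add freeE.
  have [->|vu] := eqVneq v u.
    rewrite /hc_rate /= yE eqxx /= (hc_addK free); ring.
  by rewrite !mul0r addr0 /hc_rate /= yE (negbTE vu).
- move=> -[v [|]]; rewrite /w /b /=.
    rewrite hc_rate_add; case: (boolP (hc_free x v)) => [freev _|_];
      last by rewrite mulr0 ltxx.
    have [->|vu] := eqVneq v u; first by rewrite eqxx.
    case: (boolP (e u v)) => uv.
      by rewrite -{4}(hc_addK freev) hc_adj_del ?orbT // val_hc_add ?eqxx.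
    (* For [v] other than [u] and its neighbours, both copies gain [v] and still differ exactly by
       [u]. *)
    have freev' : hc_free (hc_move (v, true) x) u.
      apply/hc_freeP; split=> [|k uk]; rewrite val_hc_add //.
        by rewrite eq_sym (negbTE vu).
      by rewrite (negbTE (xN _ uk)) orbF; apply: contraNneq uv => <-.
    have -> : hc_move (v, true) y = hc_move (u, true) (hc_move (v, true) x).
      apply: hc_state_ext => k; rewrite !val_hc_add ?freeE // ?yE.
      by rewrite orbCA.
    by rewrite hc_adj_add ?orbT.
  move=> _; have [->|vu] := eqVneq v u.
    by rewrite hc_addK // hc_del_id ?eqxx.
  have freev' : hc_free (hc_move (v, false) x) u.
    apply/hc_freeP; split=> [|k uk]; rewrite val_hc_del ?(negbTE xu) ?andbF //.
    by rewrite (negbTE (xN _ uk)) andbF.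
  have -> : hc_move (v, false) y = hc_move (u, true) (hc_move (v, false) x).
    apply: hc_state_ext => k; rewrite val_hc_del val_hc_add // val_hc_del yE.
    by have [->|//] := eqVneq k u; rewrite eq_sym vu.
  by rewrite hc_adj_add ?orbT.
(* The copies merge when [x] gains [u], at rate [beta], and when [y] loses [u] by itself, at rate
   [1 - S]; these two rates already suffice. *)
- rewrite (bigD1 (u, true)) // (bigD1 (u, false)) ?xpair_eqE ?andbF //=.
  rewrite {1 2}/w /b /= eqxx.
  rewrite hc_addK // hc_del_id // !eqxx hc_rate_add free !mulr1.
  apply: (@le_trans _ _ (beta + (1 - S + 0))); first by move: leS; lra.
  rewrite !lerD2l sumr_ge0 // => m _; rewrite mulr_ge0 // /w.
  case: ifP => _; last exact: hc_rate_ge0.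
  by rewrite subr_ge0 (le_trans leS).
Qed.

Theorem hc_contraction :
  Ric_cc_inf_ge X (1 - beta * ((max_degree e)%:R - 1)) /\
  Wp_contraction X (1 - beta * ((max_degree e)%:R - 1)).
Proof.
apply: jump_coupling_contraction => [|x y /hc_adjP[u [[free ->]|[free ->]]]].
- exact: hc_irreducible.
- exact: hc_jump_coupling.
- by apply: jump_coupling_sym; [exact: hc_adj_sym | exact: hc_jump_coupling].
Qed.

End Hardcore.

Theorem theorem5p18 (R : realType) :
  (forall (T : finType) (G : {set {ffun T -> T}}) (H : T -> R) (beta : R),
     0 < beta ->
     (forall s : {ffun T -> T}, s \in G -> ~ (forall x, s x = x)) ->
     irreducible_chain (glauber G H beta) ->
     reversible_chain (glauber G H beta) ->
     (forall (x : T) (s g : {ffun T -> T}), s \in G -> g \in G ->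
        [/\ s (g x) = g (s x), s (s x) = x & 0 <= glauber_kappa G H beta x s]) ->
     Ric_cc_inf_ge (glauber G H beta) (glauber_kappa_star G H beta) /\
     Wp_contraction (glauber G H beta) (glauber_kappa_star G H beta))
  /\
  (forall L N : nat, (N < L)%N ->
     Ric_cc_inf_ge (bernoulli_laplace R L N) L%:R /\
     Wp_contraction (bernoulli_laplace R L N) L%:R)
  /\
  (forall (V : finType) (e : rel V) (beta : R) (beta_gt0 : 0 < beta),
     symmetric e -> irreflexive e -> (forall x y, connect e x y) ->
     beta < 1 ->
     beta * (max_degree e)%:R <= 1 ->
     Ric_cc_inf_ge (hardcore e beta_gt0)
       (1 - beta * ((max_degree e)%:R - 1)) /\
     Wp_contraction (hardcore e beta_gt0)
       (1 - beta * ((max_degree e)%:R - 1))).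
Proof.
split; last split.
- move=> T G H beta _ _ irr _ comm.
  by apply: glauber_contraction irr => x s g sG gG; exact: comm.
- by move=> L N _; exact: bl_contraction.
- by move=> V e beta beta_gt0 e_sym e_irr _ _ small; exact: hc_contraction.
Qed.
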